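(* Let $q\geq 2$ and $n\geq 2$ be integers and let $S$ be an orientable sequence of order $n$ over $\mathbb{Z}_q$. Then the period of $S$ is at most $(q^n - q^{\lceil n/2\rceil} - q^{\lceil (n-1)/2\rceil} + q)/2$ if $q$ is odd, and at most $(q^n - q^{\lceil n/2\rceil} - q)/2$ if $q$ is even. Further, if $q$ is odd and $n\geq 6$, then the period of $S$ is at most $(q^n - 2q^{n/2} - q^{(n-2)/2} + 2q)/2$ if $n$ is even, and at most $(q^n - q^{(n+1)/2} - 2q^{(n-1)/2} + q + q^2)/2$ if $n$ is odd.
   Context: A periodic sequence $S=(s_i)$ over $\mathbb{Z}_q$ with (least) period $m$ has $n$-tuples $\mathbf{s}_n(i)=(s_i,\dots,s_{i+n-1})$. For $\mathbf{u}=(u_0,\dots,u_{n-1})$ let $\mathbf{u}^R=(u_{n-1},\dots,u_0)$. $S$ is an $n$-window sequence if $\mathbf{s}_n(i)=\mathbf{s}_n(j)$ implies $i\equiv j\pmod m$, and an orientable sequence of order $n$ if it is an $n$-window sequence with $\mathbf{s}_n(i)\neq\mathbf{s}_n(j)^R$ for all $i,j$. *)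

(* Defs.v *)
From mathcomp Require Import all_boot all_order all_algebra.

Set Implicit Arguments.
Unset Strict Implicit.
Unset Printing Implicit Defensive.

Section Sequences.

Variable T : eqType.
Implicit Types (s : nat -> T) (m n : nat).

Definition is_period s m := forall i, s (i + m) = s i.

Definition least_period s m :=
  [/\ 0 < m, is_period s m & forall k, 0 < k -> is_period s k -> m <= k].

Definition window s n (i : nat) : n.-tuple T := [tuple s (i + j) | j < n].

(* In the next two predicates m is meant to be the least period of s. *)
Definition n_window_seq s m n :=
  forall i j, window s n i = window s n j -> i = j %[mod m].

Definition orientable_seq s m n :=
  n_window_seq s m n /\
  forall i j, window s n i <> [tuple of rev (window s n j)].

End Sequences.

(* Main.v *)
Require Import Defs.
From mathcomp Require Import all_boot all_order all_algebra.
From mathcomp Require Import zify lra.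

Import Order.TTheory GRing.Theory Num.Theory.
Local Open Scope ring_scope.

(* Let W be the set of the m windows of length n = k + 1, W^R the set of their
    reversals, and M the complement of W \cup W^R, so that q^n = 2m + |M|.
    A word v of length k has as many occurrences in S that are preceded by a
    letter as occurrences that are followed by one.  If v is a palindrome, the
    number of words of W \cup W^R of the form av is therefore even, so that M
    contains a non-palindrome of this form whenever q is odd and v is not
    constant, or q is even and v is constant.  The first two bounds count these
    words and the palindromes.  The other two also count the reversals of these
    words: a word of the form av which is also of the form v'b, with v and v'
    palindromes, is 2-periodic, so at most q^2 - q words are counted twice. *)

(** * Palindromes, constant words and one-letter extensions *)

Section Tuples.
Set Implicit Arguments.
Unset Strict Implicit.
Local Open Scope nat_scope.
Variable T : finType.

Definition palindromes n : {set n.-tuple T} := [set w | rev_tuple w == w].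

Definition constant_tuples n : {set n.-tuple T} := [set nseq_tuple n a | a : T].

(** The letter is added on the left only; words with [v] as a prefix are reached through
    [rev_tuple]. *)
Definition extensions k (v : k.-tuple T) : {set k.+1.-tuple T} :=
  [set w : k.+1.-tuple T | behead_tuple w == v].

Lemma rev_tupleK n : involutive (@rev_tuple n T).
Proof. by move=> w; apply: val_inj; rewrite /= revK. Qed.

Lemma nth_palindrome x0 n (w : n.-tuple T) i :
  w \in palindromes n -> i < n -> nth x0 w (n - i.+1) = nth x0 w i.
Proof.
rewrite inE => /eqP/(congr1 val)/= rw ltin.
by rewrite -{2}rw nth_rev ?size_tuple.
Qed.

Lemma palindromesP x0 n (w : n.-tuple T) :
  (forall i, i < n -> nth x0 w (n - i.+1) = nth x0 w i) -> w \in palindromes n.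
Proof.
move=> eqw; rewrite inE; apply/eqP/val_inj/(@eq_from_nth _ x0) => /=.
  by rewrite size_rev.
by move=> i; rewrite size_rev size_tuple => lt_in; rewrite nth_rev ?size_tuple ?eqw.
Qed.

Lemma card_palindromes_ge n : 0 < n -> #|T| ^ uphalf n <= #|palindromes n|.
Proof.
case: n => // n _; rewrite [uphalf _]/= -[_.+1]/((n./2).+1).
(* Reflecting a half-word yields a palindrome: [minn i (n - i)] is invariant under i -> n - i and
   never exceeds [n./2], so [inord] preserves it. *)
pose f (t : (n./2).+1.-tuple T) : n.+1.-tuple T :=
  [tuple tnth t (inord (minn i (n - i))) | i < n.+1].
have f_inj : injective f.
  move=> t u eqf; apply: eq_from_tnth => j.
  have lt_jn : j < n.+1 by have := ltn_ord j; lia.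
  have := congr1 (fun w => tnth w (Ordinal lt_jn)) eqf.
  rewrite !tnth_mktuple /=; have -> : minn j (n - j) = j.
    by have := ltn_ord j; lia.
  by rewrite inord_val.
rewrite -card_tuple -(card_imset predT f_inj); apply/subset_leq_card/subsetP.
move=> _ /imsetP[t _ ->]; have x0 := thead t.
apply: (@palindromesP x0) => i lt_in.
have lt_in' : n.+1 - i.+1 < n.+1 by lia.
rewrite -[nth _ _ _](tnth_nth x0 (f t) (Ordinal lt_in')).
rewrite -[RHS](tnth_nth x0 (f t) (Ordinal lt_in)) !tnth_mktuple /=.
by congr (tnth t (inord _)); lia.
Qed.

Lemma card_constant_tuples n : 0 < n -> #|constant_tuples n| = #|T|.
Proof.
case: n => // n _; rewrite card_imset // => a b.
by move/(congr1 val) => /= -[].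
Qed.

Lemma constant_tuples_palindromes n : constant_tuples n \subset palindromes n.
Proof.
apply/subsetP => _ /imsetP[a _ ->]; apply: (@palindromesP a) => i lt_in.
by rewrite !nth_nseq !if_same.
Qed.

Lemma card_extensions k (v : k.-tuple T) : #|extensions v| = #|T|.
Proof.
rewrite -(@card_imset _ _ (fun a => cons_tuple a v)); last first.
  by move=> a b /(congr1 val) /= [].
apply: eq_card => w; rewrite inE; apply/eqP/imsetP => [<-|[a _ ->]].
  by exists (thead w) => //; rewrite [LHS]tuple_eta; apply: val_inj.
exact: val_inj.
Qed.

(** The two palindromes reflect the positions of [w] by i -> k - i and i -> k + 1 - i; composing
    these reflections shifts by one. *)
Lemma palindromic_extension_constant k (v : k.-tuple T) w :
    v \in palindromes k -> w \in extensions v -> w \in palindromes k.+1 ->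
  w = nseq_tuple k.+1 (thead w).
Proof.
rewrite [in X in _ -> X]inE => pal_v /eqP def_v pal_w; have x0 := thead w.
have nthv i : nth x0 v i = nth x0 w i.+1 by rewrite -def_v nth_behead.
have step i : i < k -> nth x0 w i.+1 = nth x0 w i.
  move=> lt_ik; rewrite -nthv -(nth_palindrome x0 pal_v lt_ik) // nthv.
  by rewrite -[RHS](nth_palindrome x0 pal_w) 1?ltnW //; congr nth; lia.
apply/val_inj/(@eq_from_nth _ x0); rewrite ?size_tuple // => i lt_ik.
rewrite nth_nseq lt_ik /thead (tnth_nth x0) /=.
by elim: i lt_ik => // i IHi lt_ik; rewrite step // IHi // ltnW.
Qed.

(** The membership is read as the number 0 or 1, ready for the parity count in [odd_missing]. *)
Lemma card_palindromic_extensions k (v : k.-tuple T) : 0 < k ->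
    v \in palindromes k ->
  #|extensions v :&: palindromes k.+1| = (v \in constant_tuples k).
Proof.
move=> k_gt0 pal_v; have [/imsetP[a _ def_v]|v_nconst] := boolP (v \in _).
  rewrite (_ : _ :&: _ = [set nseq_tuple k.+1 a]) ?cards1 //.
  apply/setP => /= w; rewrite in_setI in_set1; apply/andP/eqP => [[ext_w pal_w]|->].
    have def_w := palindromic_extension_constant pal_v ext_w pal_w.
    rewrite def_w; congr nseq_tuple; move: ext_w; rewrite inE def_w def_v.
    move/eqP/(congr1 (fun u : k.-tuple T => nth a u 0)).
    by rewrite nth_behead !nth_nseq ltnS k_gt0.
  split; first by rewrite inE def_v; apply/eqP/val_inj.
  by apply: (subsetP (constant_tuples_palindromes _)); apply: imset_f.
apply/eqP; rewrite cards_eq0; apply: contraR v_nconst => /set0Pn[/= w].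
rewrite in_setI => /andP[ext_w pal_w].
have def_w := palindromic_extension_constant pal_v ext_w pal_w.
apply/imsetP; exists (thead w) => //.
by move: ext_w; rewrite inE => /eqP <-; apply: val_inj; rewrite {1}def_w.
Qed.

(** The reflections fixing the last [k] and the first [k] letters compose to a shift by two; [odd i]
    is i modulo 2. *)
Lemma palindromic_sides_periodic2 x0 k (w : k.+1.-tuple T) i :
    behead_tuple w \in palindromes k ->
    behead_tuple (rev_tuple w) \in palindromes k ->
  i <= k -> nth x0 w i = nth x0 w (odd i).
Proof.
move=> pal_r pal_l.
have eq_r j : j < k -> nth x0 w (k - j) = nth x0 w j.+1.
  move=> lt_jk; have := nth_palindrome x0 pal_r lt_jk; rewrite !nth_behead.
  by rewrite subnSK.
have eq_l j : j < k -> nth x0 w (k - j.+1) = nth x0 w j.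
  move=> lt_jk; have := nth_palindrome x0 pal_l lt_jk; rewrite !nth_behead /=.
  rewrite !nth_rev ?size_tuple; [|lia..] => <-.
  by congr nth; lia.
have step j : j.+2 <= k -> nth x0 w j.+2 = nth x0 w j.
  by move=> le_jk; rewrite -eq_r // eq_l // ltnW.
elim/ltn_ind: i => -[|[|i]] // IHi le_ik.
by rewrite step // IHi /= ?negbK //; lia.
Qed.

(** By 2-periodicity the first two letters determine [w]. They differ, since otherwise [w] would be
    constant, hence a palindrome. *)
Lemma card_two_palindromic_sides k : 0 < k ->
  #|[set w : k.+1.-tuple T | [&& behead_tuple w \in palindromes k,
        behead_tuple (rev_tuple w) \in palindromes k & w \notin palindromes k.+1]]|
    <= #|T| * #|T|.-1.
Proof.
move=> k_gt0; set A := [set w | _].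
pose f (w : k.+1.-tuple T) := (thead w, nth (thead w) w 1).
have A_per w : w \in A ->
    forall x0 i, i <= k -> nth x0 w i = if odd i then (f w).2 else (f w).1.
  rewrite inE => /and3P[pal_r pal_l _] x0 i le_ik.
  rewrite (palindromic_sides_periodic2 x0 pal_r pal_l) //.
  case: odd => /=; first by apply: set_nth_default; rewrite size_tuple.
  by rewrite -[LHS](tnth_nth x0 w ord0).
have f_inj : {in A &, injective f}.
  move=> w u Aw Au eqf; apply: val_inj; apply: (@eq_from_nth _ (thead w)).
    by rewrite !size_tuple.
  by move=> i; rewrite size_tuple ltnS => le_ik; rewrite (A_per w) ?(A_per u) ?eqf.
pose B := [set p : T * T | p.1 != p.2].
have cardB : #|B| + #|T| = #|T| * #|T|.
  rewrite -card_prod -(cardsC B); congr addn.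
  rewrite -(@card_imset _ _ (fun a : T => (a, a))) => [|a b []//].
  apply: eq_card => -[a b]; rewrite !inE negbK /=.
  by apply/imsetP/eqP => [[c _ [-> ->]]|->] //; exists b.
have -> : #|T| * #|T|.-1 = #|B| by nia.
rewrite -(card_in_imset f_inj); apply/subset_leq_card/subsetP.
move=> _ /imsetP[w Aw ->]; rewrite inE; apply/eqP => eqf.
have const i : i <= k -> nth (thead w) w i = (f w).2.
  by move=> le_ik; rewrite A_per // eqf if_same.
move: Aw; rewrite inE => /and3P[_ _ /negP]; apply.
by apply: (@palindromesP (thead w)) => i le_ik; rewrite !const //; lia.
Qed.

End Tuples.

(** * Windows of an orientable sequence and the missing words *)

Section Counting.
Set Implicit Arguments.
Unset Strict Implicit.
Local Open Scope nat_scope.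
Variables (T : finType) (s : nat -> T) (m k : nat).
Hypotheses (k_gt0 : 0 < k) (s_per : is_period s m) (m_gt0 : 0 < m).
Hypothesis s_or : orientable_seq s m k.+1.

Let q := #|T|.
Let W := [set window s k.+1 (i : nat) | i : 'I_m].
Let M := ~: (W :|: [set rev_tuple w | w in W]).
(** By [cardN], bounding [m] from above amounts to bounding the palindromes and [N] from below. *)
Let N := M :\: palindromes T k.+1.

Let window_inj : injective (fun i : 'I_m => window s k.+1 i).
Proof.
by move=> i j /(s_or.1 _ _); rewrite !modn_small ?ltn_ord // => /val_inj.
Qed.

Let rev_inj n : injective (@rev_tuple n T).
Proof. exact: can_inj (@rev_tupleK T n). Qed.

Let mem_revW w : (w \in [set rev_tuple u | u in W]) = (rev_tuple w \in W).
Proof. by rewrite -[w in LHS]rev_tupleK (mem_imset _ _ (@rev_inj _)). Qed.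

Let disjW : [disjoint W & [set rev_tuple w | w in W]].
Proof.
rewrite disjoint_subset; apply/subsetP => _ /imsetP[i _ ->].
rewrite inE; apply/imsetP => -[_ /imsetP[j _ ->]].
by move/(s_or.2 i j).
Qed.

Let cardM : 2 * m + #|M| = q ^ k.+1.
Proof.
rewrite -card_tuple -(cardsC (W :|: [set rev_tuple w | w in W])).
congr addn; rewrite cardsU disjoint_setI0 // cards0 subn0.
by rewrite (card_imset _ (@rev_inj _)) (card_imset _ window_inj) card_ord addnn mul2n.
Qed.

Let palM : palindromes T k.+1 \subset M.
Proof.
apply/subsetP => w; rewrite !inE => /eqP rw; rewrite mem_revW rw orbb.
apply/imsetP => -[i _ def_w]; apply: (s_or.2 i i).
by rewrite -def_w -{1}rw.
Qed.

Let revM w : (rev_tuple w \in M) = (w \in M).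
Proof. by rewrite !inE !mem_revW rev_tupleK orbC. Qed.

Let revN w : (rev_tuple w \in N) = (w \in N).
Proof. by rewrite !in_setD revM !inE rev_tupleK eq_sym. Qed.

Let behead_window i : behead_tuple (window s k.+1 i) = window s k i.+1.
Proof.
apply: (@eq_from_tnth) => j; rewrite tnth_mktuple (tnth_nth (s 0)) nth_behead.
have lt_jk : j.+1 < k.+1 by rewrite ltnS.
rewrite -[LHS](tnth_nth (s 0) (window s k.+1 i) (Ordinal lt_jk)).
by rewrite tnth_mktuple addSnnS.
Qed.

Let behead_rev_window i :
  behead_tuple (rev_tuple (window s k.+1 i)) = rev_tuple (window s k i).
Proof.
apply: (@eq_from_tnth) => j; rewrite !(tnth_nth (s 0)) nth_behead.
rewrite !nth_rev ?size_tuple ?ltnS //.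
have lt1 : k.+1 - j.+2 < k.+1 by lia.
have lt2 : k - j.+1 < k by have := ltn_ord j; lia.
rewrite -[LHS](tnth_nth (s 0) (window s k.+1 i) (Ordinal lt1)).
rewrite -[RHS](tnth_nth (s 0) (window s k i) (Ordinal lt2)).
by rewrite !tnth_mktuple /=.
Qed.

(** As [v] is its own reversal, the left side counts the occurrences of [v] at positions i and the
    right side those at i + 1, with i running over one period. *)
Let balance v : v \in palindromes T k ->
  #|extensions v :&: [set rev_tuple w | w in W]| = #|extensions v :&: W|.
Proof.
rewrite inE => /eqP rv.
have -> : extensions v :&: [set rev_tuple w | w in W] =
    [set rev_tuple w | w in [set window s k.+1 (i : nat) |
                               i : 'I_m & window s k i == v]].
  apply/setP => w; rewrite in_setI mem_revW inE.
  rewrite -[w in RHS]rev_tupleK (mem_imset _ _ (@rev_inj _)) //.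
  apply/andP/imsetP => [[/eqP ext_w /imsetP[i _ def_w]]|[i]].
    exists i => //; rewrite inE -rv -ext_w -[w]rev_tupleK def_w.
    by rewrite behead_rev_window rev_tupleK.
  rewrite inE => /eqP def_v def_w; split; last by rewrite def_w; apply/imsetP; exists i.
  by rewrite -[w]rev_tupleK def_w behead_rev_window def_v rv.
have -> : extensions v :&: W =
    [set window s k.+1 (i : nat) | i : 'I_m & window s k i.+1 == v].
  apply/setP => w; rewrite in_setI inE.
  apply/andP/imsetP => [[/eqP ext_w /imsetP[i _ def_w]]|[i]].
    by exists i => //; rewrite inE -ext_w def_w behead_window.
  by rewrite inE => /eqP def_v ->;
    rewrite behead_window def_v; split=> //; apply/imsetP; exists i.
rewrite (card_imset _ (@rev_inj _)) !(card_imset _ window_inj) -!sum1_card.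
under eq_bigl do rewrite inE; under [RHS]eq_bigl do rewrite inE.
rewrite big_mkcond [RHS]big_mkcond /=.
case: (m) m_gt0 s_per => // m' _ per.
(* The two sums share all terms except the first of one and the last of the other, which periodicity
   identifies. *)
rewrite big_ord_recl [RHS]big_ord_recr addnC; congr addn.
suff -> : window s k m'.+1 = window s k 0 by [].
by apply: eq_from_tnth => j; rewrite !tnth_mktuple add0n addnC per.
Qed.

(** By [balance], [W] and its reversals together take an even number of the [q] extensions of [v].
    The rest lie in [M], and dropping the palindromes removes one word exactly when [v] is
    constant. *)
Let odd_missing v : v \in palindromes T k ->
  odd #|extensions v :&: N| = odd q (+) (v \in constant_tuples T k).
Proof.
move=> pal_v.
have cardE : 2 * #|extensions v :&: W| + #|extensions v :&: M| = q.
  rewrite /q -(card_extensions v) -[RHS](cardsID (W :|: [set rev_tuple w | w in W])).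
  rewrite /M -setDE; congr addn; rewrite setIUr cardsU balance // mul2n -addnn.
  by rewrite setIACA setIid (disjoint_setI0 disjW) setI0 cards0 subn0 //.
rewrite -cardE oddD mul2n odd_double addFb.
rewrite -(cardsID (palindromes T k.+1) (_ :&: M)) oddD -setIA (setIidPr palM).
by rewrite card_palindromic_extensions // oddb setIDA addbAC addbb.
Qed.

(** The palindromes with an odd, hence positive, number of extensions in [N]: the nonconstant ones
    for odd [q], the constant ones for even [q]. *)
Let V := [set v in palindromes T k | odd q (+) (v \in constant_tuples T k)].
Let E := [set w in N | behead_tuple w \in V].

Let cardE_ge : #|V| <= #|E|.
Proof.
apply: leq_trans (leq_imset_card (@behead_tuple k.+1 T) E).
apply/subset_leq_card/subsetP => v; rewrite inE => /andP[pal_v odd_v].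
have: 0 < #|extensions v :&: N| by rewrite odd_gt0 ?odd_missing.
case/card_gt0P => w; rewrite in_setI [w \in extensions _]inE => /andP[/eqP def_v Nw].
by apply/imsetP; exists w => //; rewrite inE Nw def_v inE pal_v.
Qed.

Let cardN : 2 * m + #|palindromes T k.+1| + #|N| = q ^ k.+1.
Proof. by rewrite -addnA -cardM -(cardsID (palindromes T k.+1) M) (setIidPr palM). Qed.

Let EN : E \subset N.
Proof. by apply/subsetP => w; rewrite inE => /andP[]. Qed.

(** * Bounds over the natural numbers, written additively to avoid truncated subtraction *)

Lemma orientable_bound_even : ~~ odd q -> 2 * m + q ^ uphalf k.+1 + q <= q ^ k.+1.
Proof.
move=> q_even; rewrite -cardN -addnA -[leqRHS]addnA leq_add2l.
rewrite leq_add ?card_palindromes_ge //.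
apply: leq_trans (leq_trans cardE_ge (subset_leq_card EN)).
(* For even [q] the term [q] counts the constant words, all of which lie in [V]. *)
rewrite /q -(card_constant_tuples T k_gt0); apply/subset_leq_card/subsetP => v const_v.
by rewrite inE const_v (negPf q_even) (subsetP (constant_tuples_palindromes _ _)).
Qed.

Let cardV_odd : odd q -> q ^ uphalf k <= #|V| + q.
Proof.
move=> q_odd; apply: leq_trans (card_palindromes_ge T k_gt0) _.
rewrite -(cardsID (constant_tuples T k)) addnC leq_add //.
  apply/subset_leq_card/subsetP => v; rewrite in_setD [v \in V]inE q_odd.
  by case/andP=> /negPf-> ->.
by rewrite /q -(card_constant_tuples T k_gt0) subset_leq_card ?subsetIr.
Qed.

Lemma orientable_bound_odd :
  odd q -> 2 * m + q ^ uphalf k.+1 + q ^ uphalf k <= q ^ k.+1 + q.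
Proof.
move=> q_odd; rewrite -cardN.
have := card_palindromes_ge T (ltn0Sn k); have := cardV_odd q_odd.
have := leq_trans cardE_ge (subset_leq_card EN); rewrite -/q; lia.
Qed.

(** [N] is closed under reversal, so it also contains the reversals of [E]. Words in both sets are
    non-palindromes with palindromic sides, whence |N| >= 2|V| - q(q - 1). *)
Lemma orientable_bound_odd2 :
  odd q -> 2 * m + q ^ uphalf k.+1 + 2 * q ^ uphalf k <= q ^ k.+1 + q + q ^ 2.
Proof.
move=> q_odd; rewrite -cardN.
pose E' := [set rev_tuple w | w in E].
have E'N : E' \subset N.
  by apply/subsetP => _ /imsetP[w /(subsetP EN) Nw ->]; rewrite revN.
have leN : #|E| + #|E| <= #|N| + #|E :&: E'|.
  rewrite -{2}(card_imset E (@rev_inj _)) -cardsUI leq_add2r subset_leq_card //.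
  by rewrite subUset EN.
have leI : #|E :&: E'| <= q * q.-1.
  apply: leq_trans (card_two_palindromic_sides T k_gt0).
  apply/subset_leq_card/subsetP => w; rewrite in_setI => /andP[Ew].
  rewrite -[w in w \in E']rev_tupleK (mem_imset _ _ (@rev_inj _)) // => Erw.
  have V_pal v : v \in V -> v \in palindromes T k by rewrite inE => /andP[].
  move: Ew Erw; rewrite [w \in E]inE [rev_tuple w \in E]inE => /andP[Nw Vr] /andP[_ Vl].
  by move: Nw; rewrite in_setD => /andP[nP _]; rewrite inE nP !V_pal.
have := card_palindromes_ge T (ltn0Sn k); have := cardV_odd q_odd.
have := cardE_ge; rewrite -/q.
(* Positivity makes [q.-1] a true predecessor. *)
have : 0 < q by apply/card_gt0P; exists (s 0).
nia.
Qed.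

End Counting.

(** * Passage to the rational bounds *)

Theorem theorem3 (q n m : nat) (S : nat -> 'Z_q)
    (hq : (2 <= q)%N) (hn : (2 <= n)%N)
    (hper : least_period S m) (hS : orientable_seq S m n) :
  [/\ odd q ->
        m%:R <= (q%:R ^+ n - q%:R ^+ uphalf n - q%:R ^+ uphalf (n - 1) + q%:R)
                / 2%:R :> rat,
      ~~ odd q ->
        m%:R <= (q%:R ^+ n - q%:R ^+ uphalf n - q%:R) / 2%:R :> rat,
      odd q -> (6 <= n)%N -> ~~ odd n ->
        m%:R <= (q%:R ^+ n - 2%:R * q%:R ^+ (n %/ 2) - q%:R ^+ ((n - 2) %/ 2)
                 + 2%:R * q%:R) / 2%:R :> rat
    & odd q -> (6 <= n)%N -> odd n ->
        m%:R <= (q%:R ^+ n - q%:R ^+ ((n + 1) %/ 2)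
                 - 2%:R * q%:R ^+ ((n - 1) %/ 2) + q%:R + q%:R ^+ 2)
                / 2%:R :> rat].
Proof.
case: n hn hS => [|[|k]] // _ {}hS; have [m_gt0 per _] := hper.
have cardT : #|'Z_q| = q by rewrite card_ord Zp_cast.
(* The window length is now [k.+2], so the word length [k] of the counting lemmas becomes [k.+1]. *)
have := orientable_bound_even (ltn0Sn k) per m_gt0 hS.
have := orientable_bound_odd (ltn0Sn k) per m_gt0 hS.
have := orientable_bound_odd2 (ltn0Sn k) per m_gt0 hS.
rewrite cardT => B3 B1 B2; rewrite !ler_pdivlMr ?ltr0n //.
rewrite subn1 -!natrX; split.
- by move/B1; rewrite -(ler_nat rat) !natrD natrM => B; lra.
- by move/B2; rewrite -(ler_nat rat) !natrD natrM => B; lra.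
- move=> q_odd n_ge6 n_even; have := B3 q_odd.
  have [j def_k] : exists j, k = j.*2 by exists k./2; lia.
  have -> : uphalf k.+2 = j.+1 by lia.
  have -> : uphalf k.+1 = j.+1 by lia.
  have -> : (k.+2 %/ 2 = j.+1)%N by lia.
  have -> : ((k.+2 - 2) %/ 2 = j)%N by lia.
  (* For n = 2j + 2 the bound [B3] is stronger than the claimed one by (q - 1)(q^j - q), which is
     nonnegative. *)
  have le_qj : (q <= q ^ j)%N by rewrite -{1}(expn1 q) leq_exp2l //; lia.
  rewrite expnS => B.
  have {}B : (2 * m + 2 * (q * q ^ j) + q ^ j <= q ^ k.+2 + 2 * q)%N by nia.
  by move: B; rewrite -(ler_nat rat) !natrD !natrM => B; lra.
- move=> q_odd n_ge6 n_odd; have := B3 q_odd.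
  have -> : ((k.+2 + 1) %/ 2 = uphalf k.+2)%N by lia.
  have -> : ((k.+2 - 1) %/ 2 = uphalf k.+1)%N by lia.
  by rewrite -(ler_nat rat) !natrD !natrM => B; lra.
Qed.
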